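(* Let $p$ be an odd prime, let $c\in\mathbb{Q}_p$, and let $f:\mathbb{Q}_p^2\to\mathbb{Q}_p^2$, $f(x,y)=(xy+c,x)$. Let $\mathcal{K}^-$, $\mathsf{Q}$, $\mathsf{J}_0$ and $\mathsf{C}$ be as defined in the context. If $|c|>1$, then: (a) $\displaystyle \bigcup_{n=0}^{+\infty} f^n(\mathsf{J}_0)\subset\mathcal{K}^-\subset\mathsf{C}\cup\bigcup_{n=0}^{+\infty} f^n(\mathsf{J}_0)$. In particular, (b) if $|c|=p$, then $\mathsf{J}_0=\emptyset$ and $\mathcal{K}^-\subset\mathsf{C}$; (c) if $|c|>p$, then $\mu_2(\mathcal{K}^-)=+\infty$, where $\mu_2$ is the Haar measure on the Borel $\sigma$-algebra of $\mathbb{Q}_p^2$.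
   Context: $|\cdot|$ is the $p$-adic norm on $\mathbb{Q}_p$ (with $|p|=1/p$). For $n\ge 0$, $f^n$ is the $n$-th iterate of $f$ ($f^0$ is the identity) and $f^n(S)$ is the image of the set $S$ under $f^n$. The inverse of $f$ is the map $f^{-1}(x,y)=\left(y,\frac{x-c}{y}\right)$, defined for $y\neq 0$; $f^{-n}$ denotes its $n$-th iterate. $\mathsf{Q}=\{(x,y)\in\mathbb{Q}_p^2: f^{-n}(x,y)\text{ exists for all positive integers } n\}$; writing $(x_{-n},y_{-n})=f^{-n}(x,y)$, with $(x_0,y_0)=(x,y)$, this means $y_{-n}\neq 0$ for all $n\ge 0$. The backward Julia set is $\mathcal{K}^-=\{(x,y)\in\mathsf{Q}:(f^{-n}(x,y))_{n\ge 1}\text{ is bounded}\}$, bounded with respect to $\|(x,y)\|=\max\{|x|,|y|\}$. The Haar measure $\mu$ on $\mathbb{Q}_p$ is normalized by $\mu(\mathbb{Z}_p)=1$, where $\mathbb{Z}_p$ is the set of $p$-adic integers (the closed unit ball of $\mathbb{Q}_p$), and $\mu_2=\mu\times\mu$. $(F_n)_{n\ge 0}$ is the Fibonacci sequence with $F_0=F_1=1$ and $F_n=F_{n-1}+F_{n-2}$ for $n\ge 2$. Roots and powers of norms are those of nonnegative real numbers. For $|c|>1$ define $$\mathsf{J}_0=\{(x,y)\in\mathsf{Q}: |x|<|c|,\ 1<|y|<|c|\},\qquad \mathsf{C}=\bigcup_{i=0}^{+\infty}(\mathsf{C}_i\cup\mathsf{D}_{i+2}),$$ where $$\mathsf{C}_0=\{(x,y)\in\mathsf{Q}: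 |x|<|c| \text{ and } (|y|=1\text{ or }|y|=|c|)\}\cup\{(x,y)\in\mathsf{Q}:|x|=|c|\text{ and }|y|\le|c|\},$$ and for $n\ge 0$ $$\mathsf{C}_{2n+1}=\{(x,y)\in\mathsf{Q}: |c|^{F_{2n}}<|x|\le|c|^{F_{2n+2}}\text{ and }|y|=(|c|^{-1}|x|^{F_{2n}})^{1/F_{2n+1}}\},$$ $$\mathsf{C}_{2n+2}=\{(x,y)\in\mathsf{Q}: |c|^{F_{2n+1}}<|x|\le|c|^{F_{2n+3}}\text{ and }|y|=(|c||x|^{F_{2n+1}})^{1/F_{2n+2}}\},$$ while $$\mathsf{D}_2=\{(x,y)\in\mathsf{Q}: |c|<|x|<|c|^2\text{ and }|y|=|c|\},$$ and for $n\ge 1$ $$\mathsf{D}_{2n+1}=\{(x,y)\in\mathsf{Q}: |c|^{F_{2n}}<|x|<|c|^{F_{2n+1}}\text{ and }|y|=(|c|^{-1}|x|^{F_{2n-2}})^{1/F_{2n-1}}\},$$ $$\mathsf{D}_{2n+2}=\{(x,y)\in\mathsf{Q}: |c|^{F_{2n+1}}<|x|<|c|^{F_{2n+2}}\text{ and }|y|=(|c||x|^{F_{2n-1}})^{1/F_{2n}}\}.$$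
   Formalization: The first inclusion of (a) is stated for the union of the f^n(J_0) intersected with Q: as written it fails for |c|>p, since (0,1/p) is in J_0 but f(0,1/p)=(c,0) is not in Q, hence not in K^-. *)

(* Defs.v *)
From HB Require Import structures.
From mathcomp Require Import all_boot all_order all_algebra.
From mathcomp Require Import all_classical all_reals all_analysis.
Set Implicit Arguments.
Unset Strict Implicit.
Unset Printing Implicit Defensive.
Import Order.TTheory GRing.Theory Num.Theory.

Local Open Scope classical_set_scope.
Local Open Scope ring_scope.

(* The inverse limit of the rings Z/p^n Z: [residue x n] is the representative
   of x mod p ^ n in [0, p ^ n) (the bound follows from coherence).  The proof
   that p is prime is a parameter of the type because the integral domain
   structure depends on it. *)
Record padic_int (p : nat) (p_pr : prime p) := PadicInt {
  residue :> nat -> nat;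
  residue_mod : forall n, (residue n.+1 %% p ^ n = residue n)%N }.

Section PadicInt.
Variables (p : nat) (p_pr : prime p).
Local Notation Zp := (padic_int p_pr).
Implicit Types x y z : Zp.

HB.instance Definition _ := gen_eqMixin Zp.
HB.instance Definition _ := gen_choiceMixin Zp.

Lemma padic_int_eq x y : (forall n, x n = y n) -> x = y.
Proof.
case: x y => [x xP] [y yP] /= /funext xy; subst y.
by congr PadicInt; apply: Prop_irrelevance.
Qed.

Lemma residue_modn x m n : (n <= m)%N -> (x m %% p ^ n = x n)%N.
Proof.
elim: m => [|m IHm].
  by rewrite leqn0 => /eqP ->; rewrite -{1}(residue_mod x 0) modn_mod residue_mod.
rewrite leq_eqVlt => /orP[/eqP -> |]; last first.
  rewrite ltnS => nm.
  by rewrite -(IHm nm) -(residue_mod x m) modn_dvdm // dvdn_exp2l.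
by rewrite -(residue_mod x m.+1) modn_mod.
Qed.

Fact zero_subproof n : (0 %% p ^ n = 0)%N. Proof. exact: mod0n. Qed.
Definition padic_int0 : Zp := PadicInt p_pr (residue := fun=> 0%N) zero_subproof.

Fact one_subproof n : ((1 %% p ^ n.+1) %% p ^ n = 1 %% p ^ n)%N.
Proof. by rewrite modn_dvdm // dvdn_exp2l. Qed.
Definition padic_int1 : Zp :=
  PadicInt p_pr (residue := fun n => (1 %% p ^ n)%N) one_subproof.

Fact opp_subproof x n :
  (((p ^ n.+1 - x n.+1) %% p ^ n.+1) %% p ^ n = (p ^ n - x n) %% p ^ n)%N.
Proof.
have xlt k : (x k < p ^ k)%N.
  by rewrite -(residue_mod x k) ltn_mod expn_gt0 prime_gt0.
rewrite modn_dvdm ?dvdn_exp2l //; apply/eqP.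
rewrite -(eqn_modDr (x n.+1)) subnK; last exact: ltnW.
rewrite -modnDmr residue_mod subnK; last exact: ltnW.
by rewrite expnS modnMl modnn.
Qed.
Definition padic_int_opp x : Zp :=
  PadicInt p_pr (residue := fun n => ((p ^ n - x n) %% p ^ n)%N)
    (opp_subproof x).

Fact add_subproof x y n :
  (((x n.+1 + y n.+1) %% p ^ n.+1) %% p ^ n = (x n + y n) %% p ^ n)%N.
Proof. by rewrite modn_dvdm ?dvdn_exp2l // -modnDm !residue_mod. Qed.
Definition padic_int_add x y : Zp :=
  PadicInt p_pr (residue := fun n => ((x n + y n) %% p ^ n)%N)
    (add_subproof x y).

Fact mul_subproof x y n :
  (((x n.+1 * y n.+1) %% p ^ n.+1) %% p ^ n = (x n * y n) %% p ^ n)%N.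
Proof. by rewrite modn_dvdm ?dvdn_exp2l // -modnMm !residue_mod. Qed.
Definition padic_int_mul x y : Zp :=
  PadicInt p_pr (residue := fun n => ((x n * y n) %% p ^ n)%N)
    (mul_subproof x y).

Fact padic_int_addA : associative padic_int_add.
Proof.
by move=> x y z; apply: padic_int_eq => n /=; rewrite modnDmr modnDml addnA.
Qed.
Fact padic_int_addC : commutative padic_int_add.
Proof. by move=> x y; apply: padic_int_eq => n /=; rewrite addnC. Qed.
Fact padic_int_add0 : left_id padic_int0 padic_int_add.
Proof.
by move=> x; apply: padic_int_eq => n /=; rewrite add0n residue_modn.
Qed.
Fact padic_int_addN : left_inverse padic_int0 padic_int_opp padic_int_add.
Proof.
move=> x; apply: padic_int_eq => n /=; rewrite modnDml subnK ?modnn //.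
by rewrite -(residue_mod x n) ltnW // ltn_mod expn_gt0 prime_gt0.
Qed.
HB.instance Definition _ := GRing.isZmodule.Build Zp
  padic_int_addA padic_int_addC padic_int_add0 padic_int_addN.

Fact padic_int_mulA : associative padic_int_mul.
Proof.
by move=> x y z; apply: padic_int_eq => n /=; rewrite modnMmr modnMml mulnA.
Qed.
Fact padic_int_mulC : commutative padic_int_mul.
Proof. by move=> x y; apply: padic_int_eq => n /=; rewrite mulnC. Qed.
Fact padic_int_mul1 : left_id padic_int1 padic_int_mul.
Proof.
by move=> x; apply: padic_int_eq => n /=; rewrite modnMml mul1n residue_modn.
Qed.
Fact padic_int_mulDl : left_distributive padic_int_mul padic_int_add.
Proof.
move=> x y z; apply: padic_int_eq => n /=.
by rewrite modnMml modnDm mulnDl.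
Qed.
Fact padic_int_1neq0 : padic_int1 != padic_int0.
Proof.
apply/eqP => /(congr1 (fun x : Zp => x 1%N)) /=.
by rewrite expn1 modn_small // prime_gt1.
Qed.
HB.instance Definition _ := GRing.Zmodule_isComNzRing.Build Zp
  padic_int_mulA padic_int_mulC padic_int_mul1 padic_int_mulDl padic_int_1neq0.

Lemma residue0 n : (0 : Zp) n = 0%N. Proof. by []. Qed.
Lemma residueD x y n : (x + y) n = ((x n + y n) %% p ^ n)%N.
Proof. by []. Qed.
Lemma residueM x y n : (x * y) n = ((x n * y n) %% p ^ n)%N.
Proof. by []. Qed.

Definition padic_int_unit : {pred Zp} := [pred x | `[< exists y, y * x = 1 >]].
Definition padic_int_inv x : Zp :=
  if pselect (exists y, y * x = 1) is left h then projT1 (cid h) else x.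

Fact padic_int_mulV : {in padic_int_unit, left_inverse 1 padic_int_inv *%R}.
Proof.
move=> x /asboolP xU; rewrite /padic_int_inv.
by case: pselect => // h; case: cid.
Qed.
Fact padic_int_unitP x y : y * x = 1 -> padic_int_unit x.
Proof. by move=> yx; apply/asboolP; exists y. Qed.
Fact padic_int_inv_out : {in [predC padic_int_unit], padic_int_inv =1 id}.
Proof.
move=> x /asboolPn xU; rewrite /padic_int_inv.
by case: pselect.
Qed.
HB.instance Definition _ := GRing.ComNzRing_hasMulInverse.Build Zp
  padic_int_mulV padic_int_unitP padic_int_inv_out.

(* The largest n such that p ^ n divides x (and 0 if x = 0). *)
Definition padic_int_val x : nat :=
  if pselect (exists n, x n.+1 != 0%N) is left h then ex_minn h else 0%N.

Lemma padic_int_valP x : x != 0 ->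
  x (padic_int_val x) = 0%N /\ x (padic_int_val x).+1 != 0%N.
Proof.
move=> x0; have [x00 xn] : x 0%N = 0%N /\ exists n, x n.+1 != 0%N.
  have x00 : x 0%N = 0%N by rewrite -(residue_mod x 0) expn0 modn1.
  split=> //; apply: contrapT => /forallNP xn.
  case/eqP: x0; apply: padic_int_eq => -[|n]; first by rewrite x00.
  by apply/eqP/negPn/negP/xn.
rewrite /padic_int_val; case: pselect => // h; case: ex_minnP => -[|m] // hm mmin.
by split=> //; apply/eqP/negPn/negP => /mmin; rewrite ltnn.
Qed.

Lemma padic_int_val_ge x n : x != 0 -> (n <= padic_int_val x)%N = (x n == 0%N).
Proof.
move=> /padic_int_valP[v0 v1]; apply/idP/eqP => [nv|xn0].
  by rewrite -(residue_modn x nv) v0 mod0n.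
rewrite leqNgt; apply/negP => vn; move: v1.
by rewrite -(residue_modn x vn) xn0 mod0n.
Qed.

Lemma residue_dvd x m n : (n <= m)%N -> (p ^ n %| x m)%N = (x n == 0%N).
Proof. by move=> nm; rewrite /dvdn residue_modn. Qed.

Lemma padic_int_mul_neq0 x y : x != 0 -> y != 0 ->
  let m := (padic_int_val x + padic_int_val y)%N in
  (x * y) m = 0%N /\ (x * y) m.+1 != 0%N.
Proof.
move=> x0 y0 m.
have [vx vx1] := padic_int_valP x0; have [vy vy1] := padic_int_valP y0.
split.
  rewrite residueM; apply/eqP; rewrite -/(dvdn _ _) expnD dvdn_mul //.
  - by rewrite residue_dvd ?leq_addr // vx.
  - by rewrite residue_dvd ?leq_addl // vy.
have xm : x m.+1 != 0%N.
  by apply: contra vx1 => /eqP h; rewrite -(@residue_modn x m.+1) ?ltnS ?leq_addr // h mod0n.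
have ym : y m.+1 != 0%N.
  by apply: contra vy1 => /eqP h; rewrite -(@residue_modn y m.+1) ?ltnS ?leq_addl // h mod0n.
rewrite residueM -/(dvdn _ _) pfactor_dvdn ?muln_gt0 ?lt0n ?xm // lognM ?lt0n //.
have lx : (logn p (x m.+1) < (padic_int_val x).+1)%N.
  by rewrite ltnNge -pfactor_dvdn ?lt0n // residue_dvd // ltnS leq_addr.
have ly : (logn p (y m.+1) < (padic_int_val y).+1)%N.
  by rewrite ltnNge -pfactor_dvdn ?lt0n // residue_dvd // ltnS leq_addl.
by rewrite -ltnNge ltnS leq_add.
Qed.

Fact padic_int_integral : GRing.integral_domain_axiom Zp.
Proof.
move=> x y xy0; apply: contrapT => /negP.
rewrite negb_or => /andP[x0 y0].
by have [_] := padic_int_mul_neq0 x0 y0; rewrite xy0 residue0.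
Qed.
HB.instance Definition _ :=
  GRing.ComUnitRing_isIntegral.Build Zp padic_int_integral.

Lemma padic_int_valM x y : x != 0 -> y != 0 ->
  padic_int_val (x * y) = (padic_int_val x + padic_int_val y)%N.
Proof.
move=> x0 y0; have xy0 : x * y != 0 by rewrite mulf_neq0.
have [h1 h2] := padic_int_mul_neq0 x0 y0.
apply/eqP; rewrite eqn_leq padic_int_val_ge // h1 eqxx andbT.
by rewrite leqNgt padic_int_val_ge.
Qed.

Definition padic_int_norm x : rat :=
  if x == 0 then 0 else p%:R ^- padic_int_val x.

Let p_gt0 : 0 < p%:R :> rat. Proof. by rewrite ltr0n prime_gt0. Qed.

Lemma padic_int_norm_ge0 x : 0 <= padic_int_norm x.
Proof. by rewrite /padic_int_norm; case: ifP => // _; rewrite invr_ge0 exprn_ge0 // ltW. Qed.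

Lemma padic_int_norm_eq0 x : (padic_int_norm x == 0) = (x == 0).
Proof.
rewrite /padic_int_norm; case: ifP => // _.
by rewrite invr_eq0 expf_eq0 gt_eqF // andbF.
Qed.

Lemma padic_int_normM : {morph padic_int_norm : x y / x * y}.
Proof.
move=> x y; rewrite /padic_int_norm mulf_eq0.
case: (eqVneq x 0) => [_|x0] /=; first by rewrite mul0r.
case: (eqVneq y 0) => [_|y0] /=; first by rewrite mulr0.
by rewrite padic_int_valM // exprD invfM.
Qed.

Lemma padic_int_norm_le x n : (padic_int_norm x <= p%:R ^- n) = (x n == 0%N).
Proof.
rewrite /padic_int_norm; have [->|x0] := eqVneq x 0.
  by rewrite residue0 eqxx invr_ge0 exprn_ge0 // ltW.
rewrite lef_pV2 ?posrE ?exprn_gt0 // -padic_int_val_ge // ler_eXn2l //.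
by rewrite ltr1n prime_gt1.
Qed.

Lemma padic_int_normD x y :
  padic_int_norm (x + y) <= Num.max (padic_int_norm x) (padic_int_norm y).
Proof.
have key u v : padic_int_norm u <= padic_int_norm v ->
    padic_int_norm (u + v) <= padic_int_norm v.
  have [->|v0] := eqVneq v 0; first by rewrite addr0.
  have -> : padic_int_norm v = p%:R ^- padic_int_val v.
    by rewrite /padic_int_norm (negPf v0).
  rewrite !padic_int_norm_le => /eqP u0; rewrite residueD u0 add0n.
  by rewrite residue_modn //; have [->] := padic_int_valP v0.
case/orP: (le_total (padic_int_norm x) (padic_int_norm y)) => h.
  by rewrite (max_idPr h) key.
by rewrite (max_idPl h) addrC key.
Qed.

Lemma padic_int_norm1 : padic_int_norm 1 = 1.
Proof.
have h : padic_int_norm 1 != 0 by rewrite padic_int_norm_eq0 oner_eq0.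
by apply: (mulfI h); rewrite -padic_int_normM !mulr1.
Qed.

End PadicInt.

Definition padic (p : nat) (p_pr : prime p) := {fraction (padic_int p_pr)}.

HB.instance Definition _ p (p_pr : prime p) := GRing.Field.on (padic p_pr).
HB.instance Definition _ p (p_pr : prime p) :=
  isPointed.Build (padic p_pr) 0.

Section Padic.
Variables (p : nat) (p_pr : prime p).
Local Notation Qp := (padic p_pr).
Implicit Types x y z : Qp.

(* |n/d| = |n|/|d| on a fraction representing x, independently of the fraction
   (see [padic_normE]); the values lie in {0} and the powers of p, hence in rat. *)
Definition padic_norm x : rat :=
  padic_int_norm (frac (repr x)).1 / padic_int_norm (frac (repr x)).2.

Lemma padic_fracP x : exists n d : padic_int p_pr,
  [/\ d != 0, x * FracField.tofrac d = FracField.tofrac n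
    & padic_norm x = padic_int_norm n / padic_int_norm d].
Proof.
exists (frac (repr x)).1, (frac (repr x)).2; split=> //; first exact: denom_ratioP.
rewrite -[X in X * _]reprK; set r := repr x.
rewrite !piE; apply/eqP; rewrite eqmodE /= FracField.equivfE.
rewrite /FracField.mulf !numden_Ratio ?mulf_neq0 ?oner_eq0 ?denom_ratioP //.
by rewrite !mulr1 mulrC.
Qed.

Lemma padic_normE x (n d : padic_int p_pr) : d != 0 ->
  x * FracField.tofrac d = FracField.tofrac n ->
  padic_norm x = padic_int_norm n / padic_int_norm d.
Proof.
move=> d0 xd; have [n' [d' [d'0 xd' ->]]] := padic_fracP x.
have e : n' * d = n * d'.
  by apply/eqP; rewrite -tofrac_eq !tofracM -xd -xd' mulrAC.
apply/eqP; rewrite eqr_div ?padic_int_norm_eq0 //.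
by rewrite -!padic_int_normM e.
Qed.

Lemma padic_norm_ge0 x : 0 <= padic_norm x.
Proof. by rewrite divr_ge0 ?padic_int_norm_ge0. Qed.

Lemma padic_norm_eq0 x : (padic_norm x == 0) = (x == 0).
Proof.
have [n [d [d0 xd ->]]] := padic_fracP x.
rewrite mulf_eq0 invr_eq0 !padic_int_norm_eq0 (negPf d0) orbF.
by rewrite -[n == 0]tofrac_eq0 -xd mulf_eq0 tofrac_eq0 (negPf d0) orbF.
Qed.

Lemma padic_normM : {morph padic_norm : x y / x * y}.
Proof.
move=> x y; have [n [d [d0 xd ->]]] := padic_fracP x.
have [n' [d' [d'0 xd' ->]]] := padic_fracP y.
rewrite (@padic_normE _ (n * n') (d * d')) ?mulf_neq0 //.
  by rewrite !padic_int_normM mulf_div.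
by rewrite !tofracM -xd -xd' mulrACA.
Qed.

Lemma padic_normD x y :
  padic_norm (x + y) <= Num.max (padic_norm x) (padic_norm y).
Proof.
have [n [d [d0 xd ->]]] := padic_fracP x.
have [n' [d' [d'0 xd' ->]]] := padic_fracP y.
rewrite (@padic_normE _ (n * d' + n' * d) (d * d')) ?mulf_neq0 //; last first.
  by rewrite tofracD !tofracM -xd -xd' mulrDl mulrA mulrAC [FracField.tofrac d * _]mulrC mulrA mulrAC.
have pos u : u != 0 -> 0 < padic_int_norm u :> rat.
  by rewrite -padic_int_norm_eq0 lt_def => ->; rewrite padic_int_norm_ge0.
rewrite ler_pdivrMr ?pos ?mulf_neq0 // maxr_pMl; last exact: padic_int_norm_ge0.
apply: le_trans (padic_int_normD _ _) _; rewrite !padic_int_normM.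
rewrite mulrA divfK ?padic_int_norm_eq0 // [X in _ <= Num.max _ (_ * X)]mulrC.
by rewrite mulrA divfK ?padic_int_norm_eq0.
Qed.

Lemma padic_normN x : padic_norm (- x) = padic_norm x.
Proof.
have h : padic_norm (-1) ^+ 2 = 1.
  rewrite expr2 -padic_normM mulrNN mulr1.
  have h : padic_norm 1 != 0 by rewrite padic_norm_eq0 oner_eq0.
  by apply: (mulfI h); rewrite -padic_normM !mulr1.
have -> : - x = -1 * x by rewrite mulN1r.
rewrite padic_normM; suff -> : padic_norm (-1) = 1 by rewrite mul1r.
by apply/eqP; rewrite -(@eqrXn2 _ 2) ?padic_norm_ge0 // h expr1n.
Qed.

Definition padic_dist x y : rat := padic_norm (x - y).

Fact padic_dist_ge0 x y : 0 <= padic_dist x y.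
Proof. exact: padic_norm_ge0. Qed.
Fact padic_distxx x : padic_dist x x = 0.
Proof. by apply/eqP; rewrite padic_norm_eq0 subrr. Qed.
Fact padic_dist_sym x y : padic_dist x y = padic_dist y x.
Proof. by rewrite /padic_dist -padic_normN opprB. Qed.
Fact padic_dist_triangle y x z :
  padic_dist x z <= padic_dist x y + padic_dist y z.
Proof.
rewrite /padic_dist -(subrKA y x); apply: le_trans (padic_normD _ _) _.
by rewrite ge_max lerDl lerDr !padic_norm_ge0.
Qed.
Fact padic_dist_eq0 x y : padic_dist x y = 0 -> x = y.
Proof. by move/eqP; rewrite padic_norm_eq0 subr_eq0 => /eqP. Qed.
End Padic.

(* The library wants the distance in a fixed numFieldType; rat is enough to
   define the topology. *)
HB.instance Definition _ p (p_pr : prime p) :=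
  @isMetric.Build rat (padic p_pr) (@padic_dist p p_pr) (@padic_distxx p p_pr)
    (@padic_dist_eq0 p p_pr) (@padic_dist_sym p p_pr)
    (@padic_dist_triangle p p_pr).

Definition padic_borel (p : nat) (p_pr : prime p) :=
  g_sigma_algebraType (@open (padic p_pr)).

(* Translation invariance and the value on the unit ball Z_p determine mu on the
   Borel sets. *)
Definition is_haar_measure (R : realType) (p : nat) (p_pr : prime p)
    (mu : {measure set (padic_borel p_pr) -> \bar R}) : Prop :=
  (forall (a : padic p_pr) (A : set (padic_borel p_pr)),
      measurable A -> mu [set a + x | x in (A : set (padic p_pr))] = mu A) /\
  mu [set x : padic p_pr | padic_norm x <= 1] = 1%E.

Definition rnorm (R : realType) (p : nat) (p_pr : prime p)
    (x : padic p_pr) : R := ratr (padic_norm x).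

Fixpoint fib (n : nat) : nat :=
  match n with
  | 0 => 1
  | 1 => 1
  | (k.+1 as m).+1 => fib m + fib k
  end%N.

Section Dynamics.
Variables (R : realType) (p : nat) (p_pr : prime p) (c : padic p_pr).
Local Notation Qp := (padic p_pr).
Local Notation N x := (rnorm R x).
Implicit Types z : Qp * Qp.

Definition fdyn z : Qp * Qp := (z.1 * z.2 + c, z.1).

(* Meaningful only for z.2 != 0 (division by zero gives 0); on [Qset] no iterate
   ever meets the exceptional case. *)
Definition fdyn_inv z : Qp * Qp := (z.2, (z.1 - c) / z.2).

Definition Qset : set (Qp * Qp) :=
  [set z | forall n, (iter n fdyn_inv z).2 != 0].

Definition norm2 z : R := Num.max (N z.1) (N z.2).

Definition Kminus : set (Qp * Qp) :=
  [set z | Qset z /\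
    exists M : R, forall n, (1 <= n)%N -> norm2 (iter n fdyn_inv z) <= M].

Definition J0 : set (Qp * Qp) :=
  [set z | [/\ Qset z, N z.1 < N c & 1 < N z.2 < N c]].

Definition C_0 : set (Qp * Qp) :=
  [set z | [/\ Qset z, N z.1 < N c & N z.2 = 1 \/ N z.2 = N c]] `|`
  [set z | [/\ Qset z, N z.1 = N c & N z.2 <= N c]].

(* C_{2n+1} *)
Definition C_odd (n : nat) : set (Qp * Qp) :=
  [set z | [/\ Qset z,
    N c ^+ fib (2 * n) < N z.1 <= N c ^+ fib (2 * n + 2)
    & N z.2 = ((N c)^-1 * N z.1 ^+ fib (2 * n)) `^ (fib (2 * n + 1))%:R^-1 ]].

(* C_{2n+2} *)
Definition C_even (n : nat) : set (Qp * Qp) :=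
  [set z | [/\ Qset z,
    N c ^+ fib (2 * n + 1) < N z.1 <= N c ^+ fib (2 * n + 3)
    & N z.2 = (N c * N z.1 ^+ fib (2 * n + 1)) `^ (fib (2 * n + 2))%:R^-1 ]].

Definition D_2 : set (Qp * Qp) :=
  [set z | [/\ Qset z, N c < N z.1 < N c ^+ 2 & N z.2 = N c ]].

(* D_{2n+1}, only for n >= 1 *)
Definition D_odd (n : nat) : set (Qp * Qp) :=
  [set z | [/\ Qset z,
    N c ^+ fib (2 * n) < N z.1 < N c ^+ fib (2 * n + 1)
    & N z.2 = ((N c)^-1 * N z.1 ^+ fib (2 * n - 2)) `^ (fib (2 * n - 1))%:R^-1 ]].

(* D_{2n+2}, only for n >= 1 *)
Definition D_even (n : nat) : set (Qp * Qp) :=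
  [set z | [/\ Qset z,
    N c ^+ fib (2 * n + 1) < N z.1 < N c ^+ fib (2 * n + 2)
    & N z.2 = (N c * N z.1 ^+ fib (2 * n - 1)) `^ (fib (2 * n))%:R^-1 ]].

Definition C_ (i : nat) : set (Qp * Qp) :=
  if i == 0%N then C_0 else if odd i then C_odd i./2 else C_even (i./2).-1.

(* Only used for i >= 2. *)
Definition D_ (i : nat) : set (Qp * Qp) :=
  if i == 2%N then D_2 else if odd i then D_odd i./2 else D_even (i./2).-1.

Definition Cset : set (Qp * Qp) := \bigcup_i (C_ i `|` D_ i.+2).

End Dynamics.

Arguments fdyn {p p_pr} c z.
Arguments fdyn_inv {p p_pr} c z.
Arguments Qset {p p_pr} c.

(* Main.v *)
Require Import Defs.
From mathcomp Require Import all_boot all_order all_algebra.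
From mathcomp Require Import all_classical all_reals all_analysis.
From mathcomp Require Import ring lra zify.
Set Implicit Arguments.
Unset Strict Implicit.
Unset Printing Implicit Defensive.
Import Order.TTheory GRing.Theory Num.Theory.
Local Open Scope classical_set_scope.
Local Open Scope ring_scope.

(* Write L = |c| and let r_n be the norms along a backward orbit, so that
   (r_n, r_{n+1}) are the norms of the coordinates of f^{-n}(x, y).  By the
   ultrametric inequality r_{n+1} r_{n+2} is L if r_n < L, is r_n if r_n > L, and
   is at most L if r_n = L.  Hence J0 is backward invariant, and a backward orbit
   that meets r_n > L, r_{n+1} < 1 is unbounded.  A bounded orbit avoiding J0
   therefore satisfies r_n = r_{n+1} r_{n+2} until it enters |x| <= L, and it
   does so with one of the two norms equal to L; solving this Fibonacci recursion
   and eliminating the other norm with Cassini's identity gives C_i and D_i.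

   For the measure, start from (2c, pc) and apply f: since |2| = 1 the first
   iterate of f^{-1} at this point is in J0.  The unit polydiscs around the
   forward iterates are contained in Kminus, because the conditions on the
   backward orbit only depend on the coordinates modulo 1 + p Z_p; they are
   pairwise disjoint and, by translation invariance alone, of measure 1. *)

Lemma bernoulli_ineq (R : realFieldType) k (e : R) :
  1 < e -> 1 + k%:R * (e - 1) <= e ^+ k.
Proof.
move=> e1; have e0 : 0 < e by exact: lt_trans e1.
elim: k => [|k IHk]; first by rewrite mul0r addr0.
rewrite exprS; apply: le_trans (ler_wpM2l (ltW e0) IHk).
have : 0 <= k%:R * (e - 1) ^+ 2 :> R by rewrite mulr_ge0 ?sqr_ge0.
rewrite -natr1; nra.
Qed.

(** * The p-adic norm *)

Section RealNorm.
Variables (R : realType) (p : nat) (p_pr : prime p).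
Local Notation Qp := (padic p_pr).
Local Notation N x := (rnorm R x).
Implicit Types x y : Qp.

Lemma rnorm_ge0 x : 0 <= N x.
Proof. by rewrite /rnorm ler0q padic_norm_ge0. Qed.

Lemma rnorm_eq0 x : (N x == 0) = (x == 0).
Proof. by rewrite /rnorm fmorph_eq0 padic_norm_eq0. Qed.

Lemma rnorm_gt0 x : (0 < N x) = (x != 0).
Proof. by rewrite lt_def rnorm_ge0 rnorm_eq0 andbT. Qed.

Lemma rnormM : {morph @rnorm R p p_pr : x y / x * y}.
Proof. by move=> x y; rewrite /rnorm padic_normM rmorphM. Qed.

Lemma rnormN x : N (- x) = N x.
Proof. by rewrite /rnorm padic_normN. Qed.

Lemma rnorm_subC x y : N (x - y) = N (y - x).
Proof. by rewrite -opprB rnormN. Qed.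

Lemma rnorm1 : N (1 : Qp) = 1.
Proof.
have h : N (1 : Qp) != 0 by rewrite rnorm_eq0 oner_eq0.
by apply: (mulfI h); rewrite -rnormM !mulr1.
Qed.

Lemma rnorm_div x y : y != 0 -> N (x / y) = N x / N y.
Proof.
move=> y0; apply: (canRL (mulfK _)); first by rewrite rnorm_eq0.
by rewrite -rnormM divfK.
Qed.

Lemma rnormD x y : N (x + y) <= Num.max (N x) (N y).
Proof.
have := padic_normD x y; rewrite -(ler_rat R) => /le_trans; apply.
by rewrite le_max; case: (leP (padic_norm x) (padic_norm y)) => _; rewrite lexx ?orbT.
Qed.

Lemma rnormD_le x y M : N x <= M -> N y <= M -> N (x + y) <= M.
Proof. by move=> xM yM; apply: le_trans (rnormD x y) _; rewrite ge_max xM. Qed.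

Lemma rnormD_lt x y M : N x < M -> N y < M -> N (x + y) < M.
Proof. by move=> xM yM; apply: le_lt_trans (rnormD x y) _; rewrite gt_max xM. Qed.

Lemma rnormD_dom x y : N y < N x -> N (x + y) = N x.
Proof.
move=> yx; apply: le_anti; rewrite rnormD_le ?(ltW yx) //=.
rewrite leNgt; apply/negP => xyx.
have : N (x + y - y) < N x by rewrite rnormD_lt ?rnormN.
by rewrite addrK ltxx.
Qed.

Lemma rnormB_dom x y : N y < N x -> N (x - y) = N x.
Proof. by move=> yx; rewrite rnormD_dom // rnormN. Qed.

(* The norm only takes the values 0 and p ^ k. *)
Lemma rnorm_discrete x : 1 < N x -> p%:R <= N x.
Proof.
rewrite /rnorm -(ratr_nat R p) ler_rat.
have -> : (1 < ratr (padic_norm x) :> R) = (1 < padic_norm x).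
  by rewrite -(ltr_rat R) rmorph1.
have [n [d [d0 xd ->]]] := padic_fracP x.
have pgt0 : 0 < p%:R :> rat by rewrite ltr0n prime_gt0.
rewrite /padic_int_norm (negPf d0); case: ifP => [_|_].
  by rewrite mul0r ltr10.
rewrite invrK; set a := padic_int_val n; set b := padic_int_val d.
have [ba|ab] := leqP b a => h.
  exfalso; move: h; rewrite ltNge; case/negP.
  rewrite mulrC ler_pdivrMr ?exprn_gt0 // mul1r ler_weXn2l //.
  by rewrite ler1n prime_gt0.
rewrite mulrC ler_pdivlMr ?exprn_gt0 // -exprS ler_weXn2l //.
by rewrite ler1n prime_gt0.
Qed.

End RealNorm.

(** * Bounded backward orbits *)

Section BackwardOrbits.
Variables (R : realType) (p : nat) (p_pr : prime p) (c : padic p_pr).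
Local Notation Qp := (padic p_pr).
Local Notation N x := (rnorm R x).
Local Notation L := (rnorm R c).
Local Notation finv := (fdyn_inv c).
Implicit Types z : Qp * Qp.

Lemma fdyn_invK z : z.2 != 0 -> fdyn c (finv z) = z.
Proof. by case: z => x y /= y0; rewrite /fdyn /= mulrC divfK // subrK. Qed.

Lemma fdynK z : z.1 != 0 -> finv (fdyn c z) = z.
Proof. by case: z => x y /= x0; rewrite /fdyn_inv /= addrK mulrC mulKf. Qed.

Lemma QsetS z : Qset c z <-> z.2 != 0 /\ Qset c (finv z).
Proof.
split=> [Qz|[z0 Qz] [|n]].
- by split=> [|n]; [exact: (Qz 0%N) | rewrite -iterSr; exact: Qz].
- exact: z0.
- by rewrite iterSr; exact: Qz.
Qed.

Lemma Qset_iter n z : Qset c z -> Qset c (iter n finv z).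
Proof.
by move=> Qz; elim: n => [|n IHn]; [exact: Qz|case/QsetS: IHn].
Qed.

Lemma iter_fdyn_invK n z : Qset c z -> iter n (fdyn c) (iter n finv z) = z.
Proof.
elim: n z => // n IHn z Qz; rewrite iterSr iterS fdyn_invK.
  by rewrite IHn.
by have /QsetS[] := Qset_iter n Qz.
Qed.

Lemma iter_fdynK n z :
  Qset c (iter n (fdyn c) z) -> iter n finv (iter n (fdyn c) z) = z.
Proof.
elim: n => [//|n IHn] Qz; have [z0 Qfz] := (QsetS _).1 Qz.
rewrite iterS in z0 Qfz *; rewrite iterSr fdynK; last exact: z0.
by apply: IHn; rewrite fdynK in Qfz; [exact: Qfz|exact: z0].
Qed.

Lemma KminusS z : Kminus R c z <-> z.2 != 0 /\ Kminus R c (finv z).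
Proof.
split=> [[Qz [M zM]]|[z0 [Qz [M zM]]]].
  have [z0 Qfz] := (QsetS z).1 Qz; split=> //; split=> //.
  by exists M => n n1; rewrite -iterSr; apply: zM.
split; first exact/QsetS.
exists (Num.max M (norm2 R (finv z))) => -[//|[|n]] _.
  by rewrite le_max lexx orbT.
by rewrite iterSr le_max zM.
Qed.

Lemma Kminus_of_iter n z : Qset c z -> Kminus R c (iter n finv z) -> Kminus R c z.
Proof.
elim: n => [|n IHn] Qz Kz; first exact: Kz.
apply: IHn; first exact: Qz; apply/KminusS; split; last exact: Kz.
by have /QsetS[] := Qset_iter n Qz.
Qed.

Lemma rnorm_finv2 z : z.2 != 0 -> N (finv z).2 = N (z.1 - c) / N z.2.
Proof. exact: rnorm_div. Qed.

Lemma rnorm_subc_lt (x : Qp) : N x < L -> N (x - c) = L.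
Proof. by move=> xc; rewrite rnorm_subC rnormB_dom. Qed.

Lemma rnorm_subc_le (x : Qp) : N x <= L -> N (x - c) <= L.
Proof. by move=> xc; rewrite rnormD_le ?rnormN. Qed.

Hypothesis L_gt1 : 1 < L.

Let L_gt0 : 0 < L. Proof. exact: lt_trans ltr01 L_gt1. Qed.

Definition J0_box : set (Qp * Qp) := [set z | N z.1 < L /\ 1 < N z.2 < L].

Lemma J0_box_finv z : J0_box z -> z.2 != 0 /\ J0_box (finv z).
Proof.
move=> [x1 /andP[y1 yL]]; have y0 : 0 < N z.2 by apply: lt_trans y1.
have z2 : z.2 != 0 by rewrite -(rnorm_gt0 R).
split=> //; split=> //; rewrite rnorm_finv2 // rnorm_subc_lt //.
by rewrite ltr_pdivlMr // mul1r yL ltr_pdivrMr // ltr_pMr.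
Qed.

Lemma J0_box_iter n z : J0_box z -> J0_box (iter n finv z).
Proof. by move=> Jz; elim: n => // n /J0_box_finv[]. Qed.

Lemma J0E : J0 R c = J0_box.
Proof.
apply/seteqP; split=> z [] //= x1 y1; split=> // n.
by have /J0_box_finv[] : J0_box (iter n finv z) by apply: J0_box_iter.
Qed.

Lemma J0_sub_Kminus : J0 R c `<=` Kminus R c.
Proof.
move=> z Jz; split; first by have [] := Jz.
exists L => n _; rewrite J0E in Jz.
have [x1 /andP[_ y1]] := J0_box_iter n Jz.
by rewrite /norm2 ge_max !ltW.
Qed.

Lemma images_J0_sub_Kminus :
  \bigcup_n (iter n (fdyn c) @` J0 R c) `&` Qset c `<=` Kminus R c.
Proof.
move=> _ [[n _ [z Jz <-]] Qz]; apply: (Kminus_of_iter (n := n) Qz).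
by rewrite (iter_fdynK Qz); apply: J0_sub_Kminus.
Qed.

(* Along even iterates |x| is multiplied by at least e at each step. *)
Lemma escape z : Qset c z -> L < N z.1 -> N z.2 < 1 -> ~ Kminus R c z.
Proof.
move=> Qz xL y1 [_ [M zM]].
have y0 : 0 < N z.2 by rewrite rnorm_gt0; have /QsetS[] := Qz.
pose e := Num.min (N z.1 / L) (N z.2)^-1.
have e1 : 1 < e.
  by rewrite lt_min ltr_pdivlMr // mul1r xL invf_gt1.
have e0 : 0 < e by exact: lt_trans e1.
have orb k : L * e ^+ k.+1 <= N (iter k.*2 finv z).1 /\
    N (iter k.*2 finv z).2 <= e^-1.
  elim: k => [|k [IHx IHy]].
    rewrite expr1 mulrC -ler_pdivlMr // ge_min lexx; split=> //=.
    by rewrite -[leLHS]invrK lef_pV2 ?posrE ?invr_gt0 // ge_min lexx orbT.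
  rewrite doubleS !iterS; set w := iter _ _ _ in IHx IHy *.
  have Qw : Qset c w by exact: Qset_iter.
  have [w0 /QsetS[fw0 _]] := (QsetS w).1 Qw.
  have ek1 : 1 < e ^+ k.+1 by rewrite exprn_egt1.
  have w2 : 0 < N w.2 by rewrite rnorm_gt0.
  have wL : L < N w.1 by apply: lt_le_trans IHx; rewrite ltr_pMr.
  have wy1 : N w.2 < 1 by apply: le_lt_trans IHy _; rewrite invf_lt1.
  have fx : N (finv w).2 = N w.1 / N w.2 by rewrite rnorm_finv2 // rnormB_dom.
  have x' : L * e ^+ k.+2 <= N (finv w).2.
    rewrite fx ler_pdivlMr //.
    have -> : L * e ^+ k.+2 * N w.2 = L * e ^+ k.+1 * (e * N w.2).
      by rewrite exprSr !mulrA.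
    apply: le_trans IHx; rewrite ler_piMr //.
      by rewrite mulr_ge0 ?exprn_ge0 ?(ltW L_gt0) ?(ltW e0).
    by rewrite mulrC -ler_pdivlMr // mul1r.
  split; first by [].
  have yL : N (finv w).1 < L by apply: lt_trans wy1 L_gt1.
  rewrite rnorm_finv2 // rnorm_subc_lt // ler_pdivrMr ?rnorm_gt0 //.
  rewrite mulrC ler_pdivlMr //; apply: le_trans x'; rewrite ler_pM2l //.
  by rewrite exprSr ler_peMl ?(ltW e0) // ltW.
have [k kM] : exists k, M < k%:R * (e - 1).
  exists (Num.truncn (M / (e - 1))).+1.
  by rewrite -ltr_pdivrMr ?subr_gt0 // truncnS_gt.
have := zM k.+1.*2 isT; rewrite leNgt => /negP; apply.
rewrite /norm2 lt_max; apply/orP; left.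
have [+ _] := orb k.+1; apply: lt_le_trans.
have e2 := bernoulli_ineq k e1; have ek : e ^+ k <= L * e ^+ k.+2.
  rewrite -addn2 exprD mulrCA ler_peMr ?exprn_ge0 ?(ltW e0) //.
  by rewrite mulr_ege1 ?exprn_ege1 ?(ltW e1) ?(ltW L_gt1).
by apply: lt_le_trans ek; apply: lt_le_trans e2; rewrite ltr_wpDl.
Qed.

(* Kminus minus the images of J0. *)
Definition stray : set (Qp * Qp) :=
  [set z | Kminus R c z /\ forall n, ~ J0_box (iter n finv z)].

Lemma stray_finv z : stray z -> z.2 != 0 /\ stray (finv z).
Proof.
move=> [/KminusS[z0 Kz] Jz]; split=> //; split=> // n.
by rewrite -iterSr; apply: Jz.
Qed.

Lemma stray_Qset z : stray z -> Qset c z.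
Proof. by case=> -[]. Qed.

Lemma stray_y_ge1 z : stray z -> L < N z.1 -> 1 <= N z.2.
Proof.
move=> Sz xL; rewrite leNgt; apply/negP => y1.
by apply: (escape (stray_Qset Sz) xL y1); case: Sz.
Qed.

Lemma stray_y_leL z : stray z -> N z.1 <= L -> N z.2 <= L.
Proof.
move=> Sz xL; rewrite leNgt; apply/negP => yL.
have [z0 Sfz] := stray_finv Sz; have y0 : 0 < N z.2 by rewrite rnorm_gt0.
have := stray_y_ge1 Sfz yL; rewrite rnorm_finv2 // ler_pdivlMr // mul1r.
by move/(lt_le_trans yL); rewrite ltNge rnorm_subc_le.
Qed.

Lemma stray_y_cases z : stray z -> N z.1 < L -> N z.2 = 1 \/ N z.2 = L.
Proof.
move=> Sz xL; have [z0 Sfz] := stray_finv Sz.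
have y0 : 0 < N z.2 by rewrite rnorm_gt0.
have yL := stray_y_leL Sz (ltW xL).
have [y1|y1|->] := ltgtP (N z.2) 1; last by left.
  exfalso; have [fz0 _] := stray_finv Sfz.
  have fy : N (finv z).2 = L / N z.2 by rewrite rnorm_finv2 // rnorm_subc_lt.
  have fyL : L < N (finv z).2 by rewrite fy ltr_pdivlMr // gtr_pMr.
  have [_ Sffz] := stray_finv Sfz.
  have := stray_y_ge1 Sffz fyL; rewrite rnorm_finv2 //.
  rewrite rnorm_subc_lt ?(lt_trans y1) // ler_pdivlMr ?(lt_trans L_gt0) //.
  by rewrite mul1r leNgt fyL.
move: yL; rewrite le_eqVlt => /orP[/eqP|yL]; first by right.
by case: Sz => _ /(_ 0%N); case; split=> //=; rewrite y1.
Qed.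

Lemma stray_C_0 z : stray z -> N z.1 <= L -> C_0 R c z.
Proof.
move=> Sz; have Qz := stray_Qset Sz.
rewrite le_eqVlt => /orP[/eqP xL|xL]; [right|left]; split=> //.
  by apply: stray_y_leL => //; rewrite xL.
exact: stray_y_cases.
Qed.

(* The standard Fibonacci numbers: [fib] is shifted by one. *)
Definition gib (n : nat) : nat := if n is n'.+1 then fib n' else 0%N.

Lemma gibSS n : gib n.+2 = (gib n.+1 + gib n)%N.
Proof. by case: n. Qed.

Lemma cassini n :
  (if odd n then gib n.+1 ^ 2 + 1 = gib n * gib n.+2
   else gib n.+1 ^ 2 = gib n * gib n.+2 + 1)%N.
Proof.
elim: n => // n; rewrite [odd n.+1]/= !gibSS; set a := gib n; set b := gib n.+1.
by case: (odd n) => /= h; nia.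
Qed.

(* z reaches, after k + 1 steps of finv, a point (x, y) with |x| = A, |y| = B. *)
Definition fib_pair k (A B : R) z :=
  N z.1 = A ^+ gib k.+2 * B ^+ gib k.+1 /\ N z.2 = A ^+ gib k.+1 * B ^+ gib k.

Lemma fib_pair_step k A B z : z.2 != 0 -> L < N z.1 ->
  fib_pair k A B (finv z) -> fib_pair k.+1 A B z.
Proof.
move=> z0 xL [f1 f2]; split; last by [].
have : N z.1 = N (finv z).1 * N (finv z).2.
  by rewrite rnorm_finv2 // rnormB_dom //= mulrC divfK // rnorm_eq0.
by move=> ->; rewrite f1 f2 (gibSS k.+1) exprD [in B ^+ gib k.+2]gibSS exprD mulrACA.
Qed.

Definition critical (A B : R) := (B = L /\ 1 < A <= L) \/ (A = L /\ 1 < B < L).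

Lemma stray_fib0 z : stray z -> L < N z.1 -> N z.2 <= L ->
  exists A B, critical A B /\ fib_pair 0 A B z.
Proof.
move=> Sz xL yL; have [z0 Sfz] := stray_finv Sz.
have y0 : 0 < N z.2 by rewrite rnorm_gt0.
exists (N z.2), (N (finv z).2); split; last first.
  rewrite /fib_pair /= !expr1 expr0 mulr1; split=> //.
  by rewrite rnorm_div // rnormB_dom // mulrC divfK // gt_eqF.
have fy : N (finv z).2 = N z.1 / N z.2 by rewrite rnorm_finv2 // rnormB_dom.
have fy1 : 1 < N (finv z).2.
  by rewrite fy ltr_pdivlMr // mul1r (le_lt_trans yL).
move: yL; rewrite le_eqVlt => /orP[/eqP yL|yL]; last first.
  left; have [f1|fL] := stray_y_cases Sfz yL; first by rewrite f1 ltxx in fy1.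
  split=> //; rewrite (ltW yL) andbT; move: fL; rewrite fy => fL.
  by move: xL; rewrite -[N z.1](@divfK _ (N z.2)) ?gt_eqF // fL ltr_pMr.
have := @stray_y_leL _ Sfz; rewrite /= yL => /(_ (lexx _)).
rewrite le_eqVlt => /orP[/eqP fL|fL]; [left|right]; split=> //.
  by rewrite L_gt1 lexx.
by rewrite fy1.
Qed.

Lemma stray_fib z : stray z -> L < N z.1 ->
  exists k A B, critical A B /\ fib_pair k A B z.
Proof.
move=> Sz xL; have [K xK] : exists K, N z.1 <= L ^+ K.
  have [K KM] : exists K, N z.1 < K%:R * (L - 1).
    exists (Num.truncn (N z.1 / (L - 1))).+1.
    by rewrite -ltr_pdivrMr ?subr_gt0 // truncnS_gt.
  exists K; apply: ltW; apply: lt_le_trans KM _.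
  by apply: le_trans (bernoulli_ineq K L_gt1); rewrite lerDr.
elim: K z Sz xL xK => [|K IHK] z Sz xL xK.
  by move: (lt_trans L_gt1 xL); rewrite ltNge xK.
have [z0 Sfz] := stray_finv Sz.
have y0 : 0 < N z.2 by rewrite rnorm_gt0.
have [yL|yL] := leP (N z.2) L.
  by have [A [B AB]] := stray_fib0 Sz xL yL; exists 0%N, A, B.
have [fz0 Sffz] := stray_finv Sfz.
have fy : N (finv z).2 = N z.1 / N z.2 by rewrite rnorm_finv2 // rnormB_dom.
have [fyL|fyL] := leP (N (finv z).2) L.
  have [A [B [AB fAB]]] := stray_fib0 Sfz yL fyL.
  by exists 1%N, A, B; split=> //; apply: fib_pair_step.
have fyK : N (finv z).2 <= L ^+ K.
  rewrite fy ler_pdivrMr //; apply: (le_trans xK); rewrite exprSr.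
  by rewrite ler_wpM2l ?exprn_ge0 // ltW.
have [k [A [B [AB fAB]]]] := IHK _ Sffz fyL fyK.
by exists k.+2, A, B; split=> //; apply: fib_pair_step => //; apply: fib_pair_step.
Qed.

Lemma powR_root (a b : R) n : (0 < n)%N -> 0 <= a -> a ^+ n = b -> a = b `^ n%:R^-1.
Proof.
move=> n0 a0 <-; rewrite -powR_mulrn // -powRrM divff ?powRr1 //.
by rewrite pnatr_eq0 -lt0n.
Qed.

Lemma gib_gt0 n : (0 < gib n.+1)%N.
Proof. by elim: n => // n IHn; rewrite gibSS addn_gt0 IHn. Qed.

Lemma C_oddE h : C_ R c (2 * h).+1 = C_odd R c h.
Proof. by rewrite /C_ /= mul2n odd_double /= uphalf_double. Qed.

Lemma C_evenE h : C_ R c (2 * h).+2 = C_even R c h.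
Proof. by rewrite /C_ /= mul2n odd_double /= doubleK. Qed.

Lemma D_oddE h : D_ R c (2 * h).+3 = D_odd R c h.+1.
Proof. by rewrite /D_ /= mul2n odd_double /= uphalf_double. Qed.

Lemma D_evenE h : D_ R c (2 * h).+4 = D_even R c h.+1.
Proof. by rewrite /D_ /= mul2n odd_double /= doubleK. Qed.

Lemma fib_pair_C_ k A z : Qset c z -> 1 < A <= L -> fib_pair k A L z ->
  C_ R c k.+1 z.
Proof.
move=> Qz /andP[A1 AL] [xE yE].
have A0 : 0 < A by apply: lt_trans A1.
have y0 := rnorm_ge0 R z.2; have cas := cassini k.
have bnd : L ^+ gib k.+1 < N z.1 <= L ^+ gib k.+3.
  rewrite xE; apply/andP; split.
    by rewrite ltr_pMl ?exprn_gt0 // exprn_egt1 // -lt0n gib_gt0.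
  rewrite (gibSS k.+1) exprD ler_pM2r ?exprn_gt0 //.
  by rewrite lerXn2r ?nnegrE ?(ltW A0) ?(ltW L_gt0).
have yx : N z.2 ^+ gib k.+2 * L ^+ (gib k.+1 ^ 2) =
    N z.1 ^+ gib k.+1 * L ^+ (gib k * gib k.+2).
  rewrite xE yE !exprMn -!exprM [(gib k.+2 * gib k.+1)%N]mulnC mulnn.
  by rewrite mulrAC.
have powL n : L ^+ n != 0 by rewrite expf_neq0 // gt_eqF.
have [h kE] : exists h, k = (odd k + 2 * h)%N.
  by exists k./2; rewrite mul2n odd_double_half.
move: cas kE; case: (odd k) => cas /= kE.
  rewrite addSn add0n in kE; rewrite kE C_evenE.
  rewrite /C_even /= addn1 addn2 addn3 -kE; split=> //.
  apply: powR_root => //; first exact: (gib_gt0 k.+1).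
  apply: (mulIf (powL (gib k.+1 ^ 2)%N)).
  rewrite -[fib k.+1]/(gib k.+2) -[fib k]/(gib k.+1) yx -cas exprD expr1.
  ring.
rewrite add0n in kE; rewrite kE C_oddE /C_odd /= addn1 addn2 -kE; split=> //.
apply: powR_root => //; first exact: (gib_gt0 k.+1).
apply: (mulIf (powL (gib k.+1 ^ 2)%N)).
rewrite -[fib k.+1]/(gib k.+2) -[fib k]/(gib k.+1) yx cas exprD expr1.
by field; rewrite gt_eqF.
Qed.

Lemma fib_pair_D_ k B z : Qset c z -> 1 < B < L -> fib_pair k L B z ->
  D_ R c k.+2 z.
Proof.
move=> Qz /andP[B1 BL] [xE yE].
have B0 : 0 < B by apply: lt_trans B1.
have y0 := rnorm_ge0 R z.2; have cas := cassini k.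
have bnd : L ^+ gib k.+2 < N z.1 < L ^+ gib k.+3.
  rewrite xE; apply/andP; split.
    by rewrite ltr_pMr ?exprn_gt0 // exprn_egt1 // -lt0n gib_gt0.
  rewrite (gibSS k.+1) exprD ltr_pM2l ?exprn_gt0 //.
  by rewrite ltrXn2r ?nnegrE ?(ltW B0) ?(ltW L_gt0) // -lt0n gib_gt0.
case: k xE yE cas bnd => [|k] xE yE cas bnd.
  rewrite /D_ /= !expr1 in xE yE bnd *; split=> //.
  by rewrite yE expr0 mulr1.
have yx : N z.2 ^+ gib k.+2 * L ^+ (gib k.+1 * gib k.+3) =
    N z.1 ^+ gib k.+1 * L ^+ (gib k.+2 ^ 2).
  rewrite xE yE !exprMn -!exprM [(gib k.+3 * gib k.+1)%N]mulnC mulnn.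
  by rewrite [(gib k.+2 * gib k.+1)%N]mulnC; ring.
have powL n : L ^+ n != 0 by rewrite expf_neq0 // gt_eqF.
have [h kE] : exists h, k = (odd k + 2 * h)%N.
  by exists k./2; rewrite mul2n odd_double_half.
rewrite [odd k.+1]/= in cas.
move: cas kE; case: (odd k) => cas kE; rewrite /= in kE.
  rewrite addSn add0n in kE.
  have hE : (2 * h.+1 = k.+1)%N by rewrite mulnS kE.
  rewrite [X in X.+3]kE D_evenE /D_even hE addn1 addn2 subSS subn0.
  split=> //; apply: powR_root => //; first exact: (gib_gt0 k.+1).
  apply: (mulIf (powL (gib k.+1 * gib k.+3)%N)).
  rewrite -[fib k.+1]/(gib k.+2) -[fib k]/(gib k.+1) yx cas exprD expr1.
  ring.
rewrite add0n in kE.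
have hE : (2 * h.+1 = k.+2)%N by rewrite mulnS -kE.
rewrite kE D_oddE /D_odd hE addn1 !subSS !subn0.
split=> //; apply: powR_root => //; first exact: (gib_gt0 k.+1).
apply: (mulIf (powL (gib k.+1 * gib k.+3)%N)).
rewrite -[fib k.+1]/(gib k.+2) -[fib k]/(gib k.+1) yx -cas exprD expr1.
by field; rewrite gt_eqF.
Qed.

Lemma Kminus_sub :
  Kminus R c `<=` Cset R c `|` \bigcup_n (iter n (fdyn c) @` J0 R c).
Proof.
move=> z Kz; have Qz : Qset c z by case: Kz.
have [[n Jn]|Jz] := pselect (exists n, J0_box (iter n finv z)).
  right; exists n => //; exists (iter n finv z); first by rewrite J0E.
  exact: iter_fdyn_invK.
left; have Sz : stray z by split=> // n Jn; apply: Jz; exists n.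
have [xL|xL] := leP (N z.1) L.
  by rewrite /Cset; exists 0%N; [exact: I|left; apply: stray_C_0].
have [k [A [B [AB fAB]]]] := stray_fib Sz xL.
case: AB fAB => -[-> bnd] fAB; rewrite /Cset.
  by exists k.+1; [exact: I|left; apply: fib_pair_C_ fAB].
by exists k; [exact: I|right; apply: fib_pair_D_ fAB].
Qed.

End BackwardOrbits.

Lemma J0_eq0 (R : realType) (p : nat) (p_pr : prime p) (c : padic p_pr) :
  rnorm R c = p%:R -> J0 R c = set0.
Proof.
move=> cp; rewrite -subset0 => z [_ _ /andP[/rnorm_discrete py]].
by rewrite cp ltNge py.
Qed.

(** * Measure of the backward Julia set *)

Section Multiples.
Variables (p : nat) (p_pr : prime p).
Local Notation Zp := (padic_int p_pr).

Lemma residue_nat k n : (k%:R : Zp) n = (k %% p ^ n)%N.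
Proof.
elim: k => [|k IHk]; first by rewrite residue0 mod0n.
by rewrite -addn1 natrD residueD IHk modnDm.
Qed.

Lemma padic_norm_nat k : padic_norm (k%:R : padic p_pr) = padic_int_norm (k%:R : Zp).
Proof.
rewrite (@padic_normE _ _ _ k%:R 1) ?oner_eq0 ?padic_int_norm1 ?divr1 //.
by rewrite tofrac1 mulr1 tofracMn tofrac1.
Qed.

Lemma padic_norm_prime : padic_norm (p%:R : padic p_pr) = p%:R^-1.
Proof.
have p1 := prime_gt1 p_pr; have p0 := prime_gt0 p_pr.
have r2 : (p%:R : Zp) 2%N = p.
  by rewrite residue_nat modn_small // -[ltnLHS]expn1 ltn_exp2l.
have pn0 : (p%:R : Zp) != 0.
  by apply/eqP => /(congr1 (fun x : Zp => x 2%N)); rewrite r2 residue0 => pE;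
    rewrite pE in p0.
rewrite padic_norm_nat /padic_int_norm (negPf pn0).
suff -> : padic_int_val (p%:R : Zp) = 1%N by rewrite expr1.
apply/eqP; rewrite eqn_leq padic_int_val_ge // residue_nat expn1 modnn eqxx andbT.
by rewrite leqNgt padic_int_val_ge // r2 -lt0n p0.
Qed.

Lemma padic_norm2 : odd p -> padic_norm (2%:R : padic p_pr) = 1.
Proof.
move=> p_odd; have r1 : (2%:R : Zp) 1%N != 0%N.
  rewrite residue_nat expn1 -/(dvdn p 2) gtnNdvd //.
  by rewrite ltn_neqAle prime_gt1 // andbT; apply/eqP => p2; rewrite -p2 in p_odd.
have n0 : (2%:R : Zp) != 0 by apply: contraNneq r1 => ->; rewrite residue0.
rewrite padic_norm_nat /padic_int_norm (negPf n0).
suff -> : padic_int_val (2%:R : Zp) = 0%N by rewrite expr0 invr1.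
by apply/eqP; rewrite -leqn0 leqNgt padic_int_val_ge.
Qed.

End Multiples.

Lemma subr_div2 (F : fieldType) (u v s t : F) : s != 0 -> t != 0 ->
  u / s - v / t = ((u - v) * t - v * (s - t)) / (s * t).
Proof. by move=> s0 t0; field; rewrite s0 t0. Qed.

Section Near.
Variables (R : realType) (p : nat) (p_pr : prime p).
Local Notation Qp := (padic p_pr).
Local Notation N x := (rnorm R x).
Implicit Types u v s t : Qp.

(* u / v lies in 1 + p Zp *)
Definition near_mul u v : bool := N (u - v) < N v.

Lemma near_mul_norm u v : near_mul u v -> N u = N v.
Proof. by move=> uv; rewrite -[u](subrK v) addrC rnormD_dom. Qed.

Lemma near_mul_div u v s t :
  near_mul u v -> near_mul s t -> near_mul (u / s) (v / t).
Proof.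
move=> uv st; have vu := near_mul_norm uv; have ts := near_mul_norm st.
have v0 : 0 < N v by apply: le_lt_trans uv; apply: rnorm_ge0.
have t0 : 0 < N t by apply: le_lt_trans st; apply: rnorm_ge0.
have tn0 : t != 0 by rewrite -(rnorm_gt0 R).
have sn0 : s != 0 by rewrite -(rnorm_gt0 R) ts.
rewrite /near_mul.
have st0 : s * t != 0 := mulf_neq0 sn0 tn0.
rewrite (subr_div2 _ _ sn0 tn0) (rnorm_div R _ st0) (rnorm_div R _ tn0).
rewrite [N (s * t)]rnormM ts ltr_pdivrMr; last by rewrite mulr_gt0.
rewrite mulrA (divfK (lt0r_neq0 t0)); apply: rnormD_lt.
  by rewrite rnormM ltr_pM2r.
by rewrite rnormN rnormM ltr_pM2l.
Qed.

Lemma near_mul_subr u v s : N s < N v -> near_mul u v -> near_mul (u - s) (v - s).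
Proof.
by move=> sv uv; rewrite /near_mul (rnormB_dom sv) opprB addrA subrK.
Qed.

End Near.

Section Boxes.
Variables (R : realType) (p : nat) (p_pr : prime p) (c : padic p_pr).
Local Notation Qp := (padic p_pr).
Local Notation N x := (rnorm R x).
Local Notation L := (rnorm R c).
Local Notation finv := (fdyn_inv c).
Implicit Types z w : Qp * Qp.

(* z reaches J0 after k + 1 steps of finv.  The condition |x - c| = |c| on the
   last point outside J0 makes the last step explicit. *)
Fixpoint chain (k : nat) z : Prop :=
  match k with
  | 0 => [/\ N z.1 = L, N (z.1 - c) = L & 1 < N z.2 < L]
  | j.+1 => [/\ L < N z.1, z.2 != 0 & chain j (finv z)]
  end.

Lemma chain_near k z w :
  near_mul R w.1 z.1 -> near_mul R w.2 z.2 -> chain k z -> chain k w.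
Proof.
elim: k z w => [|k IHk] z w wz1 wz2 /=.
  move=> [x1 xc y1]; rewrite (near_mul_norm wz1) (near_mul_norm wz2).
  split=> //; rewrite -[w.1](subrK z.1) -addrA addrC rnormD_dom //.
  by rewrite xc -x1.
move=> [xL z0 ch]; rewrite (near_mul_norm wz1); split=> //.
  by rewrite -(rnorm_gt0 R) (near_mul_norm wz2) rnorm_gt0.
apply: IHk ch => //; apply: near_mul_div => //.
exact: near_mul_subr.
Qed.

Hypothesis L_gt1 : 1 < L.

Let L_gt0 : 0 < L. Proof. exact: lt_trans ltr01 L_gt1. Qed.

Lemma chain_Kminus k z : chain k z -> Kminus R c z.
Proof.
elim: k z => [|k IHk] z /= [x1 xc].
  move=> /andP[y1 yL]; have y0 : 0 < N z.2 by apply: lt_trans y1.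
  have z0 : z.2 != 0 by rewrite -(rnorm_gt0 R).
  apply/KminusS; split; first exact: z0.
  apply: (J0_sub_Kminus L_gt1); rewrite (J0E L_gt1); split; first exact: yL.
  by rewrite rnorm_finv2 // xc ltr_pdivlMr // mul1r yL ltr_pdivrMr // ltr_pMr.
by move=> ch; apply/KminusS; split; [exact: xc|exact: IHk].
Qed.

Definition forward_orbit k : Qp * Qp := iter k (fdyn c) (2%:R * c, p%:R * c).

Lemma forward_orbit_step k (z := forward_orbit k) :
  L <= N z.1 -> 1 < N z.2 -> chain k z ->
  [/\ N z.1 < N (forward_orbit k.+1).1, 1 < N (forward_orbit k.+1).2
    & chain k.+1 (forward_orbit k.+1)].
Proof.
move=> x1 y1 ch; rewrite /forward_orbit iterS -/(forward_orbit k) -/z.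
have x0 : 0 < N z.1 by apply: lt_le_trans x1.
have xy : N z.1 < N (z.1 * z.2) by rewrite rnormM ltr_pMr.
have fx : N (fdyn c z).1 = N (z.1 * z.2) by rewrite rnormD_dom // (le_lt_trans x1).
have z0 : z.1 != 0 by rewrite -(rnorm_gt0 R).
split; first by rewrite fx.
  exact: lt_le_trans x1.
split; [by rewrite fx (le_lt_trans x1)|exact: z0|by rewrite fdynK].
Qed.

Hypotheses (p_odd : odd p) (pL : p%:R < L).

Lemma forward_orbit_chain k :
  [/\ L <= N (forward_orbit k).1, 1 < N (forward_orbit k).2 & chain k (forward_orbit k)].
Proof.
elim: k => [|k [x1 y1 ch]]; last first.
  have [x2 y2 ch2] := forward_orbit_step x1 y1 ch; split=> //.
  exact: le_trans x1 (ltW x2).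
have p0 : 0 < p%:R :> R by rewrite ltr0n prime_gt0.
have N2 : N (2%:R : Qp) = 1 by rewrite /rnorm padic_norm2 // rmorph1.
have Np : N (p%:R : Qp) = p%:R^-1.
  by rewrite /rnorm padic_norm_prime fmorphV /= ratr_nat.
have x1 : N (2%:R * c) = L by rewrite rnormM N2 mul1r.
have y1 : 1 < N (p%:R * c) by rewrite rnormM Np mulrC ltr_pdivlMr // mul1r.
rewrite /forward_orbit /= x1; split=> //; split=> //.
  by rewrite -[X in _ - X]mul1r -mulrBl rnormM -[2%:R]/(1 + 1) addrK rnorm1 mul1r.
rewrite y1 rnormM Np /= gtr_pMl // invf_lt1 // ltr1n prime_gt1 //.
Qed.

Lemma forward_orbit_incr :
  {homo (fun k => N (forward_orbit k).1) : j k / (j < k)%N >-> j < k}.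
Proof.
apply: homo_ltn => [y x z|k]; first exact: lt_trans.
by have [x1 y1 ch] := forward_orbit_chain k; have [] := forward_orbit_step x1 y1 ch.
Qed.

Lemma disc_sub_Kminus k z :
  N (z.1 - (forward_orbit k).1) <= 1 -> N (z.2 - (forward_orbit k).2) <= 1 ->
  Kminus R c z.
Proof.
have [x1 y1 ch] := forward_orbit_chain k => zx zy.
apply: (@chain_Kminus k); apply: chain_near ch.
  by apply: le_lt_trans zx _; apply: lt_le_trans x1.
exact: le_lt_trans y1.
Qed.

End Boxes.

Section Sections.
Variables (R : realType) (p : nat) (p_pr : prime p) (c : padic p_pr).
Local Notation Qp := (padic p_pr).
Local Notation N x := (rnorm R x).
Local Notation finv := (fdyn_inv c).
Implicit Types z w : Qp * Qp.

Definition close (d : R) z w : Prop := N (w.1 - z.1) < d /\ N (w.2 - z.2) < d.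

Lemma close_min d e z w : close (Num.min d e) z w -> close d z w /\ close e z w.
Proof. by rewrite /close !lt_min => -[/andP[? ?] /andP[? ?]]. Qed.

Lemma fdyn_inv_continuous z e : z.2 != 0 -> 0 < e ->
  exists2 d, 0 < d & forall w, close d z w -> w.2 != 0 /\ close e (finv z) (finv w).
Proof.
case: z => x y /= y0 e0.
have Ny : 0 < N y by rewrite rnorm_gt0.
have Nx : 0 < N (x - c) + 1 by rewrite ltr_wpDl ?rnorm_ge0.
pose d := Num.min (Num.min e (N y)) (Num.min (e * N y) (e * N y ^+ 2 / (N (x - c) + 1))).
exists d; first by rewrite !lt_min e0 Ny divr_gt0 // mulr_gt0 // exprn_gt0.
move=> [x' y'] [/= dx]; rewrite !lt_min => /andP[/andP[ye yy] /andP[_ dy]].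
have xe : N (x' - x) < e * N y.
  by move: dx; rewrite !lt_min => /andP[_ /andP[]].
have y'y : N y' = N y by apply: near_mul_norm.
have y'0 : y' != 0 by rewrite -(rnorm_gt0 R) y'y.
split=> //; split=> //=.
rewrite (subr_div2 _ _ y'0 y0) [x' - c - _](_ : _ = x' - x); last first.
  by rewrite opprB addrA subrK.
have yy0 : y' * y != 0 := mulf_neq0 y'0 y0.
rewrite (rnorm_div R _ yy0) [N (y' * y)]rnormM y'y ltr_pdivrMr; last exact: mulr_gt0.
apply: rnormD_lt; first by rewrite [ltLHS]rnormM [ltRHS]mulrA ltr_pM2r.
rewrite rnormN rnormM -expr2.
rewrite ltr_pdivlMr // mulrC in dy; apply: le_lt_trans dy.
by rewrite ler_wpM2r ?rnorm_ge0 // lerDl.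
Qed.

(* The conditions defining Kminus, up to time n and with bound M. *)
Definition bounded_upto n M z : Prop :=
  forall j, (j <= n)%N -> (iter j finv z).2 != 0 /\ norm2 R (iter j finv z) <= M.

Lemma norm2_le_open (M : R) z : 1 <= M -> z.2 != 0 -> norm2 R z <= M ->
  exists2 d, 0 < d & forall w, close d z w -> w.2 != 0 /\ norm2 R w <= M.
Proof.
move=> M1 z0; rewrite /norm2 ge_max => /andP[zM1 zM2].
exists (Num.min (N z.2) 1) => [|w zw]; first by rewrite lt_min rnorm_gt0 z0 ltr01.
have [[_ wz] [w1 w2]] := close_min zw; split.
  by rewrite -(rnorm_gt0 R) (near_mul_norm wz) rnorm_gt0.
rewrite ge_max -[w.1](subrK z.1) -[w.2](subrK z.2).
by rewrite (rnormD_le _ zM1) ?(rnormD_le _ zM2) // (le_trans (ltW _) M1).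
Qed.

Lemma bounded_upto_open n (M : R) z : 1 <= M -> bounded_upto n M z ->
  exists2 d, 0 < d & forall w, close d z w -> bounded_upto n M w.
Proof.
move=> M1; elim: n z => [|n IHn] z zM.
  have [z0 z0M] := zM 0%N isT; have [d d0 dP] := norm2_le_open M1 z0 z0M.
  by exists d => // w /dP wP j; rewrite leqn0 => /eqP ->.
have [z0 z0M] := zM 0%N isT; have [d d0 dP] := norm2_le_open M1 z0 z0M.
have [j jn|e e0 eP] := IHn (finv z).
  by rewrite -iterSr; apply: zM.
have [d' d'0 d'P] := fdyn_inv_continuous z0 e0.
exists (Num.min d' d); first by rewrite lt_min d'0 d0.
move=> w /close_min[/d'P[_ fw] zw] [|j] jn; first exact: dP.
by rewrite iterSr; apply: (eP _ fw).
Qed.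

Lemma KminusE : Kminus R c = \bigcup_m \bigcap_n [set z | bounded_upto n m.+1%:R z].
Proof.
apply/seteqP; split=> z; last first.
  move=> [m _ zm]; split; first by move=> n; have [] := zm n I n (leqnn n).
  by exists m.+1%:R => n _; have [] := zm n I n (leqnn n).
move=> [Qz [M zM]]; exists (Num.truncn (Num.max M (norm2 R z))) => // n _ j _.
split; first exact: Qz.
apply/ltW/le_lt_trans/truncnS_gt; rewrite le_max; case: j => [|j].
  by rewrite lexx orbT.
by rewrite zM.
Qed.

Lemma open_of_balls (U : set Qp) :
  (forall y, U y -> exists2 d : R, 0 < d & forall y', N (y' - y) < d -> U y') ->
  open U.
Proof.
move=> Uopen; rewrite openE => y /Uopen[d d0 dP].
have [q] := rat_in_itvoo d0; rewrite in_itv /= => /andP[q0 qd].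
rewrite /interior; apply/nbhs_ballP; exists q; first by rewrite /= -(ltr0q R).
move=> y' ; rewrite ballEmdist /= => yy'; apply: dP; apply: lt_trans qd.
by rewrite rnorm_subC /rnorm ltr_rat.
Qed.

Lemma measurable_open (U : set (padic_borel p_pr)) :
  open (U : set Qp) -> measurable U.
Proof. exact: sub_sigma_algebra. Qed.

(* [mu \x mu] integrates the measures of these sections, so the measurability
   of Kminus itself is not an issue. *)
Lemma measurable_xsection_Kminus x :
  measurable (xsection (Kminus R c) x : set (padic_borel p_pr)).
Proof.
have -> : xsection (Kminus R c) x =
    \bigcup_m \bigcap_n [set y | bounded_upto n m.+1%:R (x, y)].
  by rewrite xsectionE KminusE; apply/seteqP; split.
apply: bigcupT_measurable => m; apply: bigcapT_measurable => n.
apply: measurable_open; apply: open_of_balls => y /= yM.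
have [|d d0 dP] := bounded_upto_open _ yM; first by rewrite ler1n.
exists d => // y' yy'; apply: dP; split=> //=.
by rewrite subrr (eqP (_ : N 0 == 0)) // rnorm_eq0.
Qed.

End Sections.

(* F need not be measurable: the integral of a nonnegative function is a
   supremum over simple functions. *)
Lemma measure_le_integral d (T : measurableType d) (R : realType)
    (mu : {measure set T -> \bar R}) (E : set T) (F : T -> \bar R) :
  measurable E -> (forall x, 0 <= F x)%E -> (forall x, E x -> 1 <= F x)%E ->
  (mu E <= \int[mu]_x F x)%E.
Proof.
move=> mE F0 F1; rewrite ge0_integralTE //; apply: ereal_sup_ubound.
exists (indic_nnsfun R mE) => [x /=|]; last exact: sintegral_indic.
rewrite /measurable_realfun.mindic indicE.
case: (boolP (x \in E)) => [xE|_]; last exact: F0.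
by apply: F1; rewrite inE in xE.
Qed.

Section Haar.
Variables (R : realType) (p : nat) (p_pr : prime p).
Local Notation Qp := (padic p_pr).
Local Notation N x := (rnorm R x).
Variable mu : {measure set (padic_borel p_pr) -> \bar R}.

Definition unit_disc (a : Qp) : set (padic_borel p_pr) := [set x | N (x - a) <= 1].

Lemma measurable_unit_disc a : measurable (unit_disc a).
Proof.
apply: measurable_open; apply: (@open_of_balls R) => y ya.
exists 1 => // y' yy'; rewrite /unit_disc /= -[y'](subrK y) -addrA.
by rewrite rnormD_le // ltW.
Qed.

Hypothesis mu_haar : is_haar_measure mu.

Lemma haar_unit_disc a : mu (unit_disc a) = 1%E.
Proof.
have [mu_shift mu1] := mu_haar.
have D0 : unit_disc 0 = [set x : Qp | padic_norm x <= 1].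
  apply/seteqP; split=> x; rewrite /unit_disc /= subr0 /rnorm;
  by rewrite -(ler_rat R) rmorph1.
rewrite -mu1 -D0 -[RHS](mu_shift a); last exact: measurable_unit_disc.
congr (mu _); apply/seteqP; split=> x.
  move=> xa; exists (x - a); last by rewrite addrC subrK.
  by rewrite /unit_disc /= subr0.
by move=> [y + <-]; rewrite /unit_disc /= subr0 [a + y]addrC addrK.
Qed.

Lemma haar_unit_discs_infty (a : nat -> Qp) :
  (forall k, 1 < N (a k)) ->
  {homo (fun k => N (a k)) : j k / (j < k)%N >-> j < k} ->
  mu (\bigcup_k unit_disc (a k)) = +oo%E.
Proof.
move=> a1 a_incr; have normE k x : unit_disc (a k) x -> N x = N (a k).
  by move=> xa; apply: near_mul_norm; apply: le_lt_trans xa _; apply: a1.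
have disj : trivIset setT (fun k => unit_disc (a k)).
  apply/trivIsetP => j k _ _ jk; rewrite -subset0 => x [/normE xj /normE xk].
  have := xj; rewrite xk; case: (ltngtP j k) jk => // /a_incr h _ eq.
    by rewrite eq ltxx in h.
  by rewrite eq ltxx in h.
rewrite measure_bigcup // => [|k _]; last exact: measurable_unit_disc.
apply/eqyP => r r0; pose n := (Num.truncn r).+1.
apply: le_trans (nneseries_lim_ge n _); last by move=> *; exact: measure_ge0.
rewrite (eq_bigr (fun=> 1%E)) => [|k _]; last by rewrite haar_unit_disc.
rewrite big_mkcond /=; under eq_bigr do rewrite in_setT.
rewrite sumEFin lee_fin sumr_const_nat subn0.
by rewrite ltW // truncnS_gt.
Qed.

End Haar.

Lemma Kminus_infinite_measure (R : realType) (p : nat) (p_pr : prime p)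
    (c : padic p_pr) (mu : {measure set (padic_borel p_pr) -> \bar R}) :
  odd p -> p%:R < rnorm R c -> is_haar_measure mu ->
  (mu \x mu)%E (Kminus R c) = +oo%E.
Proof.
move=> p_odd pL mu_haar.
have L1 : 1 < rnorm R c by apply: lt_trans pL; rewrite ltr1n prime_gt1.
have ce k : 1 < rnorm R (forward_orbit c k).1.
  by have [+ _ _] := forward_orbit_chain L1 p_odd pL k; apply: lt_le_trans.
have Einf := haar_unit_discs_infty mu_haar ce (forward_orbit_incr L1 p_odd pL).
apply/eqP; rewrite -leye_eq -Einf; apply: measure_le_integral.
- by apply: bigcupT_measurable => k; apply: measurable_unit_disc.
- by move=> x; apply: measure_ge0.
move=> x [k _ xk] /=; rewrite -(haar_unit_disc mu_haar (forward_orbit c k).2).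
apply: le_measure; rewrite ?inE.
- exact: measurable_unit_disc.
- exact: measurable_xsection_Kminus.
move=> y yk; rewrite xsectionE /=.
exact: (disc_sub_Kminus L1 p_odd pL (k := k)).
Qed.

Theorem theorem3p2 (R : realType) (p : nat) (p_pr : prime p) (p_odd : odd p)
    (c : padic p_pr) (c_gt1 : 1 < rnorm R c) :
  [/\ (* (a); the images are taken within Q: f (0, y) = (c, 0) is not in Q *)
      \bigcup_n (iter n (fdyn c) @` J0 R c) `&` Qset c `<=` Kminus R c /\
      Kminus R c `<=` Cset R c `|` \bigcup_n (iter n (fdyn c) @` J0 R c),
      (* (b) *)
      rnorm R c = p%:R -> J0 R c = set0 /\ Kminus R c `<=` Cset R c
    & (* (c) *)
      p%:R < rnorm R c ->
      forall mu : {measure set (padic_borel p_pr) -> \bar R},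
        is_haar_measure mu -> (mu \x mu)%E (Kminus R c) = +oo%E ].
Proof.
split.
- by split; [exact: images_J0_sub_Kminus|exact: Kminus_sub].
- move=> cp; have J00 := J0_eq0 cp; split=> // z /(Kminus_sub c_gt1)[//|].
  by rewrite J00 => -[n _ []].
- by move=> pL mu mu_haar; apply: Kminus_infinite_measure.
Qed.
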